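(* Let $(\mathbf{A},p,\phi)$ and $(\mathbf{B},q,\theta)$ be categorical probabilistic triples and let $\lambda\in[0,1]$. Let $(\mathbf{2},\Lambda,\delta)$ be the categorical probabilistic triple where $\mathbf{2}$ denotes the discrete category with exactly two objects, $\operatorname{Ob}(\mathbf{2})=\{x_1,x_2\}$, $\Lambda$ is given by $\Lambda(x_1)=\lambda$, $\Lambda(x_2)=1-\lambda$, and $\delta$ denotes the Kronecker delta. Then $$\mathcal{H}\big((\mathbf{A},p,\phi)\oplus_\lambda(\mathbf{B},q,\theta)\big)=\lambda\,\mathcal{H}(\mathbf{A},p,\phi)+(1-\lambda)\,\mathcal{H}(\mathbf{B},q,\theta)+\mathcal{H}(\mathbf{2},\Lambda,\delta).$$
   Context: A categorical probabilistic triple $(\mathbf{A},p,\phi)$ consists of (1) a finite category $\mathbf{A}$; (2) a probability $p$ on the finite set $\operatorname{Ob}(\mathbf{A})$; (3) a function $\phi:\operatorname{Ob}(\mathbf{A})\times\operatorname{Ob}(\mathbf{A})\to[0,\infty)$ such that $\phi(a,a)>0$ for all objects $a$, and $\phi(b,b')=0$ whenever there is no arrow from $b$ to $b'$ in $\mathbf{A}$. The categorical entropy of a triple is $$\mathcal{H}(\mathbf{A},p,\phi):=-\sum_{a\in\operatorname{Ob}(\mathbf{A})}p(a)\ln\Big(\sum_{b\in\operatorname{Ob}(\mathbf{A})}p(b)\phi(a,b)\Big),$$ with the convention that the summand indexed by $a$ is $0$ whenever $p(a)=0$. A discrete category is one with only identity arrows. The Kronecker delta is $\delta(x,x)=1$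 and $\delta(x,y)=0$ for $x\neq y$. For $\lambda\in[0,1]$, the weighted sum $(\mathbf{A},p,\phi)\oplus_\lambda(\mathbf{B},q,\theta)$ is the triple $(\mathbf{A}\coprod\mathbf{B},\,p\oplus_\lambda q,\,\phi\oplus\theta)$, where $\mathbf{A}\coprod\mathbf{B}$ is the disjoint union (coproduct) of categories, $(p\oplus_\lambda q)(x)=\lambda p(x)$ if $x\in\operatorname{Ob}(\mathbf{A})$ and $(p\oplus_\lambda q)(x)=(1-\lambda)q(x)$ if $x\in\operatorname{Ob}(\mathbf{B})$, and $(\phi\oplus\theta)(x,y)$ equals $\phi(x,y)$ if $x,y\in\operatorname{Ob}(\mathbf{A})$, equals $\theta(x,y)$ if $x,y\in\operatorname{Ob}(\mathbf{B})$, and equals $0$ otherwise. *)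

(* Defs.v *)
From mathcomp Require Export all_boot all_order all_algebra.
From mathcomp Require Export reals exp.

Set Implicit Arguments.
Unset Strict Implicit.
Unset Printing Implicit Defensive.

Import Order.TTheory GRing.Theory Num.Theory.
Local Open Scope ring_scope.

(* Composition is written in diagrammatic order. *)
Record finCat := FinCat {
  ob : finType;
  hom : ob -> ob -> finType;
  idm : forall a, hom a a;
  compm : forall a b c, hom a b -> hom b c -> hom a c;
  comp1m : forall a b (f : hom a b), compm (idm a) f = f;
  compm1 : forall a b (f : hom a b), compm f (idm b) = f;
  compA : forall a b c d (f : hom a b) (g : hom b c) (h : hom c d),
    compm f (compm g h) = compm (compm f g) h
}.

Definition is_discrete (C : finCat) : Prop :=
  forall (a b : ob C) (f : hom a b),
    existT (fun c => hom a c) b f = existT (fun c => hom a c) a (idm a).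

Section Discrete.
Variable T : finType.

Definition disc_hom (x y : T) : finType := {u : unit | x == y}.

Definition disc_id (x : T) : disc_hom x x := exist _ tt (eqxx x).

Definition disc_comp (x y z : T) (f : disc_hom x y) (g : disc_hom y z) :
  disc_hom x z :=
  exist _ tt (introT eqP (etrans (eqP (valP f)) (eqP (valP g)))).

Lemma disc_hom_irr (x y : T) (f g : disc_hom x y) : f = g.
Proof. by apply: val_inj; case: (val f); case: (val g). Qed.

Definition discrete : finCat :=
  @FinCat T disc_hom disc_id disc_comp
    (fun _ _ _ => disc_hom_irr _ _)
    (fun _ _ _ => disc_hom_irr _ _)
    (fun _ _ _ _ _ _ _ => disc_hom_irr _ _).

Lemma discrete_is_discrete : is_discrete discrete.
Proof.
move=> a b f; have ab : a = b by apply/eqP; exact: (valP f).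
by subst b; congr existT; exact: disc_hom_irr.
Qed.

End Discrete.

Section Coproduct.
Variables A B : finCat.
Let T : finType := (ob A + ob B)%type.

Definition coprod_hom (x y : T) : finType :=
  match x, y with
  | inl a, inl a' => hom a a'
  | inr b, inr b' => hom b b'
  | _, _ => void
  end.

Definition coprod_id (x : T) : coprod_hom x x :=
  match x with inl a => idm a | inr b => idm b end.

Definition coprod_comp (x y z : T) :
  coprod_hom x y -> coprod_hom y z -> coprod_hom x z :=
  match x, y, z return coprod_hom x y -> coprod_hom y z -> coprod_hom x z with
  | inl a, inl a', inl a'' => @compm A a a' a''
  | inr b, inr b', inr b'' => @compm B b b' b''
  | inl _, inr _, _ | inr _, inl _, _ => fun f => match f with end
  | inl _, inl _, inr _ | inr _, inr _, inl _ => fun _ g => match g with end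
  end.

Lemma coprod_comp1m x y (f : coprod_hom x y) :
  coprod_comp (coprod_id x) f = f.
Proof. by case: x y f => [a|b] [a'|b'] //= f; exact: comp1m. Qed.

Lemma coprod_compm1 x y (f : coprod_hom x y) :
  coprod_comp f (coprod_id y) = f.
Proof. by case: x y f => [a|b] [a'|b'] //= f; exact: compm1. Qed.

Lemma coprod_compA x y z t (f : coprod_hom x y) (g : coprod_hom y z)
    (h : coprod_hom z t) :
  coprod_comp f (coprod_comp g h) = coprod_comp (coprod_comp f g) h.
Proof.
by case: x y z t f g h => [a|b] [a'|b'] [a''|b''] [a3|b3] //= f g h;
  exact: compA.
Qed.

Definition coprod : finCat :=
  FinCat coprod_comp1m coprod_compm1 coprod_compA.

End Coproduct.

Record catTriple (R : realType) := CatTriple {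
  base : finCat;
  prob : ob base -> R;
  phi : ob base -> ob base -> R;
  prob_ge0 : forall a, 0 <= prob a;
  prob_sum1 : \sum_a prob a = 1;
  phi_ge0 : forall a b, 0 <= phi a b;
  phi_diag_gt0 : forall a, 0 < phi a a;
  phi_eq0 : forall a b, #|hom a b| = 0%N -> phi a b = 0
}.

Arguments prob {R} c a.
Arguments phi {R} c a b.

(* The filter [prob X a != 0] is the convention that the summand at [a] is 0
   when [prob X a = 0]; for the remaining [a] the argument of [ln] is positive. *)
Definition entropy (R : realType) (X : catTriple R) : R :=
  - \sum_(a | prob X a != 0)
      prob X a * ln (\sum_b prob X b * phi X a b).

Section WeightedSum.
Variables (R : realType) (l : R) (hl : 0 <= l <= 1) (X Y : catTriple R).
Let C := coprod (base X) (base Y).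

Definition wsum_prob (x : ob C) : R :=
  match x with inl a => l * prob X a | inr b => (1 - l) * prob Y b end.

Definition wsum_phi (x y : ob C) : R :=
  match x, y with
  | inl a, inl a' => phi X a a'
  | inr b, inr b' => phi Y b b'
  | _, _ => 0
  end.

Lemma wsum_prob_ge0 x : 0 <= wsum_prob x.
Proof.
by case/andP: hl => l0 l1; case: x => [a|b] /=;
  rewrite mulr_ge0 ?prob_ge0 ?subr_ge0.
Qed.

Lemma wsum_prob_sum1 : \sum_x wsum_prob x = 1.
Proof.
by rewrite big_sumType /= -!mulr_sumr !prob_sum1 !mulr1 addrC subrK.
Qed.

Lemma wsum_phi_ge0 x y : 0 <= wsum_phi x y.
Proof. by case: x y => [a|b] [a'|b'] //=; exact: phi_ge0. Qed.

Lemma wsum_phi_diag_gt0 x : 0 < wsum_phi x x.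
Proof. by case: x => [a|b] /=; exact: phi_diag_gt0. Qed.

Lemma wsum_phi_eq0 x y : #|@hom C x y| = 0%N -> wsum_phi x y = 0.
Proof. by case: x y => [a|b] [a'|b'] //=; exact: phi_eq0. Qed.

Definition wsum : catTriple R :=
  CatTriple wsum_prob_ge0 wsum_prob_sum1 wsum_phi_ge0 wsum_phi_diag_gt0
    wsum_phi_eq0.

End WeightedSum.

Section TwoTriple.
Variables (R : realType) (l : R) (hl : 0 <= l <= 1).

(* The two objects are x_1 = true and x_2 = false. *)
Let C := discrete bool.

Definition two_prob (x : ob C) : R := if x then l else 1 - l.

Definition kronecker (x y : ob C) : R := (x == y)%:R.

Lemma two_prob_ge0 x : 0 <= two_prob x.
Proof. by case/andP: hl => l0 l1; case: x => //=; rewrite subr_ge0. Qed.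

Lemma two_prob_sum1 : \sum_x two_prob x = 1.
Proof. by rewrite big_bool /= addrC subrK. Qed.

Lemma kronecker_ge0 x y : 0 <= kronecker x y.
Proof. exact: ler0n. Qed.

Lemma kronecker_diag_gt0 x : 0 < kronecker x x.
Proof. by rewrite /kronecker eqxx ltr01. Qed.

Lemma kronecker_eq0 x y : #|@hom C x y| = 0%N -> kronecker x y = 0.
Proof.
rewrite /kronecker; case: eqP => // -> /eqP; rewrite -leqn0 leqNgt.
by case/negP; apply/card_gt0P; exists (disc_id y).
Qed.

Definition two_triple : catTriple R :=
  CatTriple two_prob_ge0 two_prob_sum1 kronecker_ge0 kronecker_diag_gt0
    kronecker_eq0.

End TwoTriple.

(* Main.v *)
Require Import Defs.
From mathcomp Require Import ring.
Import Order.TTheory GRing.Theory Num.Theory.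
Local Open Scope ring_scope.

(** Write the typicality of an object [a] for the mean similarity
    [\sum_b p b * phi a b].  In the weighted sum no similarity crosses between
    the two summands, so the typicality of an object of [X] is just multiplied
    by [l], and that of an object of [Y] by [1 - l]; the logarithm turns this
    factor into an additive constant.  As the probabilities of [X] sum to 1,
    that constant contributes [- (l * ln l)] to the entropy
    ([sum_scaled_ln_typicality]), and [Y] contributes
    [- ((1 - l) * ln (1 - l))]; together they are the entropy of the two-object
    triple ([entropy_two_triple]).

    Splitting the logarithm of a product needs both factors positive.
    Typicality is positive wherever the probability is nonzero
    ([typicality_gt0]); objects of probability zero and the degenerate weights
    [l = 0] and [l = 1] only give terms with a zero factor in front. *)

(** Off the support of the probability the terms are [0 * ln _], which vanish
    since [ln] is total; sums over a full type split along coproducts without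
    carrying a filter. *)
Lemma entropyE (R : realType) (X : catTriple R) :
  entropy X = - \sum_a prob X a * ln (\sum_b prob X b * phi X a b).
Proof.
rewrite /entropy big_mkcond /=; congr (- _); apply: eq_bigr => a _.
by case: eqP => //= ->; rewrite mul0r.
Qed.

(** The diagonal term [p a * phi a a] is already positive. *)
Lemma typicality_gt0 (R : realType) (X : catTriple R) (a : ob (base X)) :
  prob X a != 0 -> 0 < \sum_b prob X b * phi X a b.
Proof.
move=> pa_neq0; rewrite (bigD1 a) //= ltr_wpDr //.
  by apply: sumr_ge0 => b _; rewrite mulr_ge0 ?prob_ge0 ?phi_ge0.
by rewrite mulr_gt0 ?phi_diag_gt0 // lt_def pa_neq0 prob_ge0.
Qed.

(** How one summand enters the entropy of a weighted sum: scaling its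
    probabilities by [c] adds [ln c] to every log-typicality, and these
    constants average to [ln c] since the probabilities sum to 1.  At [c = 0]
    both sides vanish. *)
Lemma sum_scaled_ln_typicality (R : realType) (X : catTriple R) (c : R) :
  0 <= c ->
  \sum_a c * prob X a * ln (\sum_b c * prob X b * phi X a b) =
    c * ln c - c * entropy X.
Proof.
rewrite le_eqVlt => /predU1P[<-|c_gt0].
  by rewrite !mul0r subrr big1 // => a _; rewrite !mul0r.
rewrite entropyE mulrN opprK -[c * ln c]mulr1 -(prob_sum1 X) !mulr_sumr.
rewrite -big_split /=; apply: eq_bigr => a _.
have [->|pa_neq0] := eqVneq (prob X a) 0; first by rewrite !(mulr0, mul0r) addr0.
under eq_bigr do rewrite -mulrA.
rewrite -mulr_sumr lnM ?posrE ?typicality_gt0 //; ring.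
Qed.

(** Under the Kronecker similarity the typicality of an object is its own
    probability, so categorical entropy reduces to Shannon entropy. *)
Lemma entropy_two_triple (R : realType) (l : R) (hl : 0 <= l <= 1) :
  entropy (two_triple hl) = - (l * ln l + (1 - l) * ln (1 - l)).
Proof.
rewrite entropyE !big_bool /= /kronecker /=.
by rewrite !mulr1 !mulr0 addr0 add0r.
Qed.

Theorem proposition3 (R : realType) (X Y : catTriple R) (l : R)
    (hl : 0 <= l <= 1) :
  entropy (wsum hl X Y) =
    l * entropy X + (1 - l) * entropy Y + entropy (two_triple hl).
Proof.
have /andP[l_ge0 l_le1] := hl.
(* The cross similarities vanish, so each typicality is a sum over a single
   summand. *)
have typicality_inl a : \sum_y prob (wsum hl X Y) y * phi (wsum hl X Y) (inl a) y
    = \sum_b l * prob X b * phi X a b.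
  rewrite big_sumType /= [Z in _ + Z]big1 ?addr0 // => b _.
  by rewrite mulr0.
have typicality_inr b : \sum_y prob (wsum hl X Y) y * phi (wsum hl X Y) (inr b) y
    = \sum_a (1 - l) * prob Y a * phi Y b a.
  rewrite big_sumType /= big1 ?add0r // => a _.
  by rewrite mulr0.
rewrite entropy_two_triple entropyE big_sumType /=.
under eq_bigr do rewrite typicality_inl.
under [Z in _ + Z]eq_bigr do rewrite typicality_inr.
rewrite !sum_scaled_ln_typicality ?subr_ge0 //; ring.
Qed.
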